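(* Let $m\ge 2$ and let $\mathcal{A}=(A_{i_1i_2\ldots i_m})$ be a strong symmetric $m$th order $2$-dimensional tensor all of whose entries are nonnegative integers, each $i_k$ taking values either $1$ or $2$. Then $\mathcal{A}$ is $\{0,1\}$-CP if and only if each off-diagonal element is dominated by the corresponding diagonal elements, i.e., for all $(i_1,\ldots,i_m)\in\{1,2\}^m$, $$A_{i_1i_2\ldots i_m}\le A_{i_ki_k\ldots i_k}\qquad\text{for all }k\in\{1,\ldots,m\}.$$ Furthermore, in this case the binary cprank of $\mathcal{A}$ is $$\mathrm{cprank}_b(\mathcal{A})=A_{11\ldots 1}+A_{22\ldots 2}-A_{11\ldots 12}.$$
   Context: An $m$th order $n$-dimensional real tensor is an array $\mathcal{A}=(A_\sigma)$ of real numbers indexed by $\sigma=(i_1,\ldots,i_m)\in\{1,\ldots,n\}^m$. For such an index $\sigma$, $B(\sigma)=\{i_1,\ldots,i_m\}$ denotes its base set, i.e., the set of distinct elements occurring in $\sigma$. $\mathcal{A}$ is strong symmetric if $A_\sigma=A_\tau$ whenever $B(\sigma)=B(\tau)$. For $\beta=(b_1,\ldots,b_n)^\top\in\mathbb{R}^n$, $\beta^m$ denotes the tensor with entries $(\beta^m)_{i_1\ldots i_m}=b_{i_1}\cdots b_{i_m}$. A tensor $\mathcal{A}$ is $\{0,1\}$-CP if $\mathcal{A}=\sum_{j=1}^K\beta_j^m$ for some $K$ and some $\beta_1,\ldots,\beta_K\in\{0,1\}^n$; the smallest possible $K$ is the binary cprank of $\mathcal{A}$, denoted $\mathrm{cprank}_b(\mathcal{A})$.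 The empty sum ($K=0$) is the zero tensor. *)

(* Defs.v *)
From HB Require Import structures.
From mathcomp Require Import all_boot all_order all_algebra.
From mathcomp Require Import boolp reals.

Set Implicit Arguments.
Unset Strict Implicit.
Unset Printing Implicit Defensive.

Import Order.TTheory GRing.Theory Num.Theory.

Local Open Scope ring_scope.

(* Indices are counted from 0: the index values 1, ..., n are the elements
   0, ..., n - 1 of 'I_n. *)
Notation tensor R m n := {ffun m.-tuple 'I_n -> R}.

Definition base_set (m n : nat) (s : m.-tuple 'I_n) : {set 'I_n} :=
  [set i in s].

Definition strong_symmetric (R : realType) (m n : nat) (A : tensor R m n) :=
  forall s t : m.-tuple 'I_n, base_set s = base_set t -> A s = A t.

Definition vec_pow (R : realType) (m n : nat) (b : 'cV[R]_n) : tensor R m n :=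
  [ffun s : m.-tuple 'I_n => \prod_(k < m) b (tnth s k) 0].

Definition binary_vec (R : realType) (n : nat) (b : 'cV[R]_n) :=
  forall i, b i 0 = 0 \/ b i 0 = 1.

Definition binary_decomp (R : realType) (m n : nat) (A : tensor R m n)
    (K : nat) :=
  exists b : 'I_K -> 'cV[R]_n,
    (forall j, binary_vec (b j)) /\ A = \sum_(j < K) vec_pow m (b j).

Definition binary_CP (R : realType) (m n : nat) (A : tensor R m n) :=
  exists K : nat, binary_decomp A K.

Fact binary_CP_asbool (R : realType) (m n : nat) (A : tensor R m n) :
  binary_CP A -> exists K, `[< binary_decomp A K >].
Proof. by case=> K AK; exists K; apply/asboolP. Qed.

(* The value 0 is a default when A is not {0,1}-CP. *)
Definition cprank_b (R : realType) (m n : nat) (A : tensor R m n) : nat :=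
  match pselect (binary_CP A) with
  | left cpA => ex_minn (binary_CP_asbool cpA)
  | right _ => 0%N
  end.

Lemma cprank_bP (R : realType) (m n : nat) (A : tensor R m n) :
  binary_CP A ->
  binary_decomp A (cprank_b A) /\
  forall K, binary_decomp A K -> (cprank_b A <= K)%N.
Proof.
rewrite /cprank_b; case: pselect => // cpA _.
by case: ex_minnP => K /asboolP AK minK; split=> // K' /asboolP /minK.
Qed.

Definition diag_index (m n : nat) (i : 'I_n) : m.-tuple 'I_n :=
  [tuple i | _ < m].

(* (1, ..., 1, 2): only the last position holds the second index value. *)
Definition index_1_12 (m : nat) : m.-tuple 'I_2 :=
  [tuple if (k.+1 < m)%N then ord0 else ord_max | k < m].

(* Main.v *)
Require Import Defs.
From HB Require Import structures.
From mathcomp Require Import all_boot all_order all_algebra.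
From mathcomp Require Import boolp reals.

Set Implicit Arguments.
Unset Strict Implicit.
Unset Printing Implicit Defensive.

Import Order.TTheory GRing.Theory Num.Theory.

Local Open Scope ring_scope.

(** A binary vector is the indicator of its support, and the entry at [s] of
its power is 1 or 0 according to whether the base set of [s] lies in that
support ([vec_pow_binary]). Hence an entry of a sum of binary powers counts the
summands whose support contains the base set.

Domination is then necessary because the base set of a diagonal index drawn
from [s] is contained in that of [s], so it is covered at least as often.

In dimension 2, the base sets are {1}, {2} and {1,2}, so a strong symmetric
tensor is determined by a = A_1..1, b = A_2..2 and c = A_1..12. Under
domination, c copies of the all-one vector, a - c copies of the first unit
vector and b - c copies of the second one reproduce the tensor
([binary_decomp_of_dominated]); there are a + b - c of them. No decomposition
is shorter: by inclusion-exclusion, a + b - c is the number of summands with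
nonempty support ([binary_decomp_size_ge]). *)

Definition support_set (R : realType) n (b : 'cV[R]_n) : {set 'I_n} :=
  [set i | b i 0 == 1].

Definition indicator_vec (R : realType) n (S : {set 'I_n}) : 'cV[R]_n :=
  \col_i (i \in S)%:R.

Lemma binary_indicator_vec (R : realType) n (S : {set 'I_n}) :
  binary_vec (indicator_vec R S).
Proof. by move=> i; rewrite mxE; case: (i \in S); [right | left]. Qed.

Lemma support_indicator_vec (R : realType) n (S : {set 'I_n}) :
  support_set (indicator_vec R S) = S.
Proof.
by apply/setP=> i; rewrite !inE mxE; case: (i \in S);
   rewrite ?eqxx // eq_sym oner_eq0.
Qed.

(** A product of zeros and ones is 1 exactly when no factor vanishes. *)
Lemma vec_pow_binary (R : realType) m n (b : 'cV[R]_n) (s : m.-tuple 'I_n) :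
  binary_vec b -> vec_pow m b s = (base_set s \subset support_set b)%:R.
Proof.
move=> bin_b; rewrite ffunE; case: (boolP (_ \subset _)) => [/subsetP sub|].
  apply: big1 => k _; apply/eqP.
  by have := sub (tnth s k); rewrite !inE mem_tnth => /(_ isT).
case/subsetPn=> i; rewrite !inE => /tnthP[k ->] bk_neq1.
by rewrite (bigD1 k) //=; case: (bin_b (tnth s k)) bk_neq1 => ->;
   rewrite ?eqxx // mul0r.
Qed.

Lemma base_set_diag m n (i : 'I_n) :
  (0 < m)%N -> base_set (diag_index m i) = [set i].
Proof.
move=> m_gt0; apply/setP=> j; rewrite !inE.
apply/tnthP/eqP=> [[k ->]|->]; first by rewrite tnth_mktuple.
by exists (Ordinal m_gt0); rewrite tnth_mktuple.
Qed.

Lemma ord2_cases (i : 'I_2) : i = ord0 \/ i = ord_max.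
Proof. by case: i => [[|[|]]] // i; [left | right]; apply/val_inj. Qed.

Lemma base_set_1_12 m : (2 <= m)%N -> base_set (index_1_12 m) = setT.
Proof.
case: m => [|[|m]] // _; apply/setP=> i; rewrite !inE; apply/tnthP.
case: (ord2_cases i) => ->; first by exists ord0; rewrite tnth_mktuple.
by exists ord_max; rewrite tnth_mktuple ltnn.
Qed.

Lemma base_set_gt0 m n (s : m.-tuple 'I_n) :
  (0 < m)%N -> base_set s != set0.
Proof.
move=> m_gt0; apply/set0Pn; exists (tnth s (Ordinal m_gt0)).
by rewrite inE mem_tnth.
Qed.

Lemma binary_decomp_entry_le_diag (R : realType) m n (A : tensor R m n) K
    (s : m.-tuple 'I_n) (k : 'I_m) :
  binary_decomp A K -> A s <= A (diag_index m (tnth s k)).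
Proof.
case=> b [bin_b ->]; rewrite !sum_ffunE; apply: ler_sum => j _.
rewrite !vec_pow_binary // base_set_diag ?(leq_ltn_trans _ (ltn_ord k)) //.
rewrite ler_nat; case: (boolP (base_set s \subset _)) => // /subsetP sub.
by rewrite sub1set sub // inE mem_tnth.
Qed.

(** The bound holds summand by summand: a binary vector (x, y) contributes
x + y - x y = 1 - (1 - x) (1 - y) <= 1 to the left-hand side. *)
Lemma binary_decomp_size_ge (R : realType) m (A : tensor R m 2) K :
  (2 <= m)%N -> binary_decomp A K ->
  A (diag_index m ord0) + A (diag_index m ord_max) - A (index_1_12 m) <= K%:R.
Proof.
move=> m_ge2 [b [bin_b ->]]; rewrite !sum_ffunE -big_split -sumrB /=.
rewrite -[K in leRHS]card_ord -sumr_const; apply: ler_sum => j _.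
rewrite !vec_pow_binary // base_set_1_12 // !base_set_diag ?(ltnW m_ge2) //.
rewrite !sub1set; set S := support_set (b j).
have [S0|_] := boolP (ord0 \in S); have [S1|_] := boolP (ord_max \in S);
  rewrite lerBlDr ?add0r ?addr0 ?lerDl ?addr_ge0 //.
suff -> : S = setT by rewrite subsetT.
by apply/setP=> i; rewrite in_setT; case: (ord2_cases i) => ->.
Qed.

Lemma binary_decompD (R : realType) m n (A B : tensor R m n) K L :
  binary_decomp A K -> binary_decomp B L -> binary_decomp (A + B) (K + L).
Proof.
case=> b [bin_b ->] [c [bin_c ->]].
exists (fun j => match split j with inl i => b i | inr i => c i end); split.
  by move=> j; case: (split j).
rewrite big_split_ord; congr (_ + _); apply: eq_bigr => j _.
  by rewrite (unsplitK (inl j)).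
by rewrite (unsplitK (inr j)).
Qed.

Lemma binary_decomp_vec_powMn (R : realType) m n (b : 'cV[R]_n) K :
  binary_vec b -> binary_decomp (vec_pow m b *+ K) K.
Proof. by move=> bin_b; exists (fun=> b); rewrite sumr_const card_ord. Qed.

Lemma set_I2_cases (S : {set 'I_2}) :
  S != set0 -> [\/ S = [set ord0], S = [set ord_max] | S = setT].
Proof.
case/set0Pn=> i Si; have [S0|S0] := boolP (ord0 \in S);
  have [S1|S1] := boolP (ord_max \in S).
- by constructor 3; apply/setP=> j; rewrite inE; case: (ord2_cases j) => ->.
- constructor 1; apply/setP=> j; rewrite inE.
  by case: (ord2_cases j) => ->; rewrite ?S0 ?(negPf S1).
- constructor 2; apply/setP=> j; rewrite inE.
  by case: (ord2_cases j) => ->; rewrite ?S1 ?(negPf S0).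
- by case: (ord2_cases i) Si => ->; rewrite ?(negPf S0) ?(negPf S1).
Qed.

(** The weights come from Moebius inversion: an entry with base set {1} is
covered by the summands supported on {1} and on {1,2}, so the former must
number a - c, and symmetrically for {2}. Domination is what makes these
differences nonnegative. *)
Lemma binary_decomp_of_dominated (R : realType) m (A : tensor R m 2) :
    (2 <= m)%N -> strong_symmetric A -> (forall s, A s \is a Num.nat) ->
    A (index_1_12 m) <= A (diag_index m ord0) ->
    A (index_1_12 m) <= A (diag_index m ord_max) ->
  exists2 K : nat, binary_decomp A K &
    K%:R = A (diag_index m ord0) + A (diag_index m ord_max)
           - A (index_1_12 m).
Proof.
move=> m_ge2 symA natA; have m_gt0 := ltnW m_ge2.
have /natrP[a Aa] := natA (diag_index m ord0).
have /natrP[b Ab] := natA (diag_index m ord_max).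
have /natrP[c Ac] := natA (index_1_12 m).
rewrite Aa Ab Ac !ler_nat => c_le_a c_le_b.
exists (c + (a - c) + (b - c))%N; last first.
  by rewrite subnKC // natrD natrB // addrA.
pose V (S : {set 'I_2}) := vec_pow m (indicator_vec R S).
have -> : A = V setT *+ c + V [set ord0] *+ (a - c)
              + V [set ord_max] *+ (b - c).
  apply/ffunP=> s; rewrite !ffunE !ffunMnE.
  rewrite !vec_pow_binary; try exact: binary_indicator_vec.
  rewrite !support_indicator_vec subsetT.
  have [sE|sE|sE] := set_I2_cases (base_set_gt0 s m_gt0); rewrite sE.
  - rewrite (symA s (diag_index m ord0)) ?base_set_diag // Aa.
    by rewrite !sub1set !inE /= mul0rn addr0 -mulrnDr subnKC.
  - rewrite (symA s (diag_index m ord_max)) ?base_set_diag // Ab.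
    by rewrite !sub1set !inE /= mul0rn addr0 -mulrnDr subnKC.
  - rewrite (symA s (index_1_12 m)) ?base_set_1_12 // Ac.
    by rewrite !subTset !eqEcard !cardsT !cards1 !card_ord !andbF !mul0rn !addr0.
by do 2?apply: binary_decompD; apply: binary_decomp_vec_powMn;
   apply: binary_indicator_vec.
Qed.

Theorem theorem2p6 (R : realType) (m : nat) (hm : (2 <= m)%N)
    (A : tensor R m 2) (hsym : strong_symmetric A)
    (hnat : forall s : m.-tuple 'I_2, A s \is a Num.nat) :
  (binary_CP A <->
   forall (s : m.-tuple 'I_2) (k : 'I_m), A s <= A (diag_index m (tnth s k)))
  /\
  (binary_CP A ->
   (cprank_b A)%:R =
     A (diag_index m ord0) + A (diag_index m ord_max) - A (index_1_12 m)).
Proof.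
have m_gt0 := ltnW hm.
have dominates : binary_CP A ->
    forall s (k : 'I_m), A s <= A (diag_index m (tnth s k)).
  by case=> K decA s k; apply: binary_decomp_entry_le_diag decA.
have decomposes :
    (forall s (k : 'I_m), A s <= A (diag_index m (tnth s k))) ->
    exists2 K : nat, binary_decomp A K &
      K%:R = A (diag_index m ord0) + A (diag_index m ord_max)
             - A (index_1_12 m).
  move=> dom.
  have dom_mixed i : A (index_1_12 m) <= A (diag_index m i).
    have /tnthP[k ->] : i \in index_1_12 m.
      by have := in_setT i; rewrite -(base_set_1_12 hm) inE.
    exact: dom.
  exact: binary_decomp_of_dominated.
split; first by split=> // /decomposes[K decA _]; exists K.
move=> cpA; have [K decA KE] := decomposes (dominates cpA).
have [dec_rank rank_min] := cprank_bP cpA.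
apply/eqP; rewrite eq_le binary_decomp_size_ge // andbT -KE ler_nat.
exact: rank_min.
Qed.
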